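(* Let $K_0, K_1, K_2, \dots$ be real matrices with $d$ rows each (with possibly different numbers of columns), let $P_0\in\mathbb{R}^{d\times d}$ be the orthogonal projector onto $\mathrm{Range}(K_0)^\perp$, and define recursively, for $j\ge 1$, $$P_j = P_{j-1} - Q_jQ_j^\top .$$ Suppose that at each step $j\ge 1$ the columns of $Q_j$ form an arbitrary orthonormal basis of $\mathrm{Range}(P_{j-1}K_j)$ (i.e. no truncation is applied and all left singular directions of $P_{j-1}K_j$ with nonzero singular value are retained). Then, for all $t\ge 1$, $$\mathrm{Null}(P_{t-1}) = \mathrm{Range}\big(\widehat K_{t-1}\big),\qquad \widehat K_{t-1} = [K_0, K_1, \dots, K_{t-1}].$$
   Context: $\mathrm{Range}(A)$ denotes the column space of a matrix $A$, $\mathrm{Null}(A)$ its (right) null space, and $[K_0,\dots,K_{t-1}]$ is horizontal concatenation of matrices. If $P_{j-1}K_j=0$, then $Q_j$ has no columns and $Q_jQ_j^\top=0$. *)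

(* Defs.v *)
From HB Require Import structures.
From mathcomp Require Import all_boot all_order all_algebra.
From mathcomp Require Import reals.

Set Implicit Arguments.
Unset Strict Implicit.
Unset Printing Implicit Defensive.

Import Order.TTheory GRing.Theory Num.Theory.
Local Open Scope ring_scope.

(* MathComp's [matrix.v]/[mxalgebra.v] work with row spaces; here matrices act
   on column vectors by left multiplication, as linear maps 'cV_n -> 'cV_d. *)
Definition colspace (R : fieldType) (d n : nat) (A : 'M[R]_(d, n)) :
  {vspace 'cV[R]_d} := limg (linfun (mulmx A : 'cV[R]_n -> 'cV[R]_d)).

Definition nullspace (R : fieldType) (d n : nat) (A : 'M[R]_(d, n)) :
  {vspace 'cV[R]_n} := lker (linfun (mulmx A : 'cV[R]_n -> 'cV[R]_d)).

Lemma colspaceP (R : fieldType) (d n : nat) (A : 'M[R]_(d, n)) (x : 'cV[R]_d) :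
  reflect (exists y : 'cV[R]_n, x = A *m y) (x \in colspace A).
Proof.
apply: (iffP memv_imgP) => [[y _ ->]|[y ->]]; exists y; rewrite ?lfunE //.
exact: memvf.
Qed.

Lemma nullspaceP (R : fieldType) (d n : nat) (A : 'M[R]_(d, n)) (x : 'cV[R]_n) :
  reflect (A *m x = 0) (x \in nullspace A).
Proof. by rewrite memv_ker lfunE; apply: eqP. Qed.

Definition columns (R : Type) (d n : nat) (A : 'M[R]_(d, n)) : seq 'cV[R]_d :=
  [seq col j A | j <- enum 'I_n].

(* The standard inner product, registered as a dot product so that [orthov]
   and [orthonormal] apply to it. *)
Definition dotcv (R : realType) (d : nat) (u v : 'cV[R]_d) : R :=
  (u^T *m v) 0 0.

Section DotInstances.
Variables (R : realType) (d : nat).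

Fact dotcv_bilinear :
  bilinear_for (GRing.Scale.Law.clone _ _ *%R _)
    (GRing.Scale.Law.clone _ _ (idfun \; *%R) _) (@dotcv R d).
Proof.
split=> [w|w] a x y; rewrite /dotcv /=.
  by rewrite linearP mulmxDl -scalemxAl !mxE.
by rewrite mulmxDr -scalemxAr !mxE.
Qed.

HB.instance Definition _ :=
  bilinear_isBilinear.Build R 'cV[R]_d 'cV[R]_d R _ _ (@dotcv R d)
    dotcv_bilinear.

Fact dotcv_sym (u v : 'cV[R]_d) :
  dotcv u v = (-1) ^+ false * idfun (dotcv v u).
Proof.
by rewrite expr0 mul1r /dotcv !mxE; apply: eq_bigr => i _; rewrite !mxE mulrC.
Qed.

HB.instance Definition _ :=
  isHermitianSesquilinear.Build R 'cV[R]_d false idfun (@dotcv R d) dotcv_sym.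

Fact dotcv_gt0 (u : 'cV[R]_d) : u != 0 -> 0 < dotcv u u.
Proof.
move=> u0; rewrite /dotcv mxE.
have sq i : u^T 0 i * u i 0 = u i 0 ^+ 2 by rewrite mxE expr2.
rewrite lt_neqAle sumr_ge0 ?andbT => [|i _]; last by rewrite sq sqr_ge0.
apply: contraNN u0; rewrite eq_sym psumr_eq0 => [/allP s0|i _]; last first.
  by rewrite sq sqr_ge0.
apply/eqP/colP => i; rewrite mxE; have := s0 i (mem_index_enum i).
by rewrite /= sq sqrf_eq0 => /eqP.
Qed.

HB.instance Definition _ :=
  isDotProduct.Build R 'cV[R]_d (@dotcv R d) dotcv_gt0.

End DotInstances.

Definition orthocomp (R : realType) (d : nat) (U : {vspace 'cV[R]_d}) :
  {vspace 'cV[R]_d} := orthov (@dotcv R d) U.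

Definition orthonormal_basis (R : realType) (d : nat) (U : {vspace 'cV[R]_d})
  (s : seq 'cV[R]_d) : bool := basis_of U s && orthonormal (@dotcv R d) s.

Definition orthogonal_projector (R : realType) (d : nat)
  (U : {vspace 'cV[R]_d}) (P : 'M[R]_d) : Prop :=
  forall x : 'cV[R]_d, P *m x \in U /\ x - P *m x \in orthocomp U.

(* Main.v *)
Require Import Defs.
From HB Require Import structures.
From mathcomp Require Import all_boot all_order all_algebra.
From mathcomp Require Import reals.

(** Each [P j] is an orthogonal projector, i.e. symmetric and idempotent, and
    subtracting [Q *m Q^T] from such a [P], for [Q] an orthonormal basis of
    [Range (P *m K)], keeps it so and enlarges the null space by exactly
    [Range K]: if [P x = Q Q^T x] then [P x = P K y] for some [y], whence
    [x = (x - K y) + K y] with [P (x - K y) = 0]. *)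

Set Implicit Arguments.
Unset Strict Implicit.
Unset Printing Implicit Defensive.

Import Order.TTheory GRing.Theory Num.Theory.
Local Open Scope ring_scope.

Lemma mulmx_cV_ext (R : pzSemiRingType) (m n : nat) (A B : 'M[R]_(m, n)) :
  (forall x : 'cV_n, A *m x = B *m x) -> A = B.
Proof.
move=> eqAB; apply/matrixP => i j.
by have /colP/(_ i) := eqAB (delta_mx j 0); rewrite -!colE !mxE.
Qed.

Lemma span_columns (R : fieldType) (d n : nat) (A : 'M[R]_(d, n)) :
  (<<columns A>> = colspace A)%VS.
Proof.
apply/subv_anti/andP; split.
  apply/span_subvP => _ /mapP[j _ ->]; apply/colspaceP.
  by exists (delta_mx j 0); rewrite colE.
apply/subvP => _ /colspaceP[y ->].
have -> : A *m y = \sum_j y j 0 *: col j A.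
  apply/colP => i; rewrite mxE summxE; apply: eq_bigr => j _.
  by rewrite !mxE mulrC.
apply: memv_suml => j _; apply/memvZ/memv_span.
by apply: map_f; rewrite mem_enum.
Qed.

Lemma colspace_mxrow (R : fieldType) (d t : nat) (n : 'I_t -> nat)
    (K : forall j, 'M[R]_(d, n j)) :
  colspace (\mxrow_j K j) = (\sum_j colspace (K j))%VS.
Proof.
apply/subv_anti/andP; split; apply/subvP => x.
  move=> /colspaceP[y ->]; rewrite -[y]submxcolK mul_mxrow_mxcol.
  by apply: memv_sumr => j _; apply/colspaceP; exists (submxcol y j).
case/memv_sumP => v vK ->.
(* The preimages have sizes [n j] that vary with [j]; a dependent choice over the finite index type
   lets them be stacked into one column. *)
have /fin_all_exists[y vE] j : exists z, v j = K j *m z.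
  exact/colspaceP/vK.
apply/colspaceP; exists (\mxcol_j y j).
by rewrite mul_mxrow_mxcol; apply: eq_bigr => j _; rewrite vE.
Qed.

Lemma trmx_mul_dotcv (R : realType) (d m n : nat) (A : 'M[R]_(d, m))
    (B : 'M[R]_(d, n)) i j :
  (A^T *m B) i j = dotcv (col i A) (col j B).
Proof.
by rewrite /dotcv !mxE; apply: eq_bigr => k _; rewrite !mxE.
Qed.

Lemma orthocomp_colspaceP (R : realType) (d n : nat) (A : 'M[R]_(d, n))
    (x : 'cV[R]_d) :
  reflect (x^T *m A = 0) (x \in orthocomp (colspace A)).
Proof.
apply: (iffP mem_orthovP) => [x_perp|xA0 _ /colspaceP[y ->]].
  apply/rowP => j; rewrite trmx_mul_dotcv col_id x_perp ?mxE //.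
  by apply/colspaceP; exists (delta_mx j 0); rewrite colE.
by rewrite /= /dotcv mulmxA xA0 mul0mx mxE.
Qed.

(* The columns of [cokermx A^T] span [Range(A)^perp], and a row vector killed
   by the cokernel of [A^T] lies in the row space of [A^T]. *)
Lemma orthocompK_colspace (R : realType) (d n : nat) (A : 'M[R]_(d, n)) :
  orthocomp (orthocomp (colspace A)) = colspace A.
Proof.
apply/subv_anti/andP; split; last by rewrite /orthocomp orthov_sym.
apply/subvP => x /mem_orthovP x_perp.
suff: (x^T <= A^T)%MS.
  by move=> /submxP[y xE]; apply/colspaceP; exists y^T;
    apply: trmx_inj; rewrite trmx_mul trmxK.
rewrite submxE; apply/eqP/rowP => j.
rewrite trmx_mul_dotcv col_id x_perp ?mxE //.
apply/orthocomp_colspaceP; apply: trmx_inj.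
by rewrite trmx_mul trmxK trmx0 colE mulmxA mulmx_coker mul0mx.
Qed.

(** Makes [pairwiseP] available, which turns the recursive test on a list into a statement about two
    indices. *)
Lemma pair_ortho_rec_pairwise (R : nzRingType) (eps : bool)
    (theta : {rmorphism R -> R}) (U : lmodType R)
    (form : {hermitian U for eps & theta}) (s : seq U) :
  pair_ortho_rec form s = pairwise (fun u v => form u v == 0) s.
Proof. by elim: s => [|u s IHs] /=; rewrite ?andbT ?IHs. Qed.

Lemma orthonormal_columns_mul (R : realType) (d n : nat) (Q : 'M[R]_(d, n)) :
  orthonormal (@dotcv R d) (columns Q) -> Q^T *m Q = 1%:M.
Proof.
case/andP => /allP norm1; rewrite pair_ortho_rec_pairwise => ortho.
(* The list test compares an entry only with later ones; the case [j < i] follows by symmetry of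
   [dotcv]. *)
have dot0 (i j : 'I_n) : (i < j)%N -> dotcv (col i Q) (col j Q) = 0.
  have size_cols : size (columns Q) = n by rewrite size_map size_enum_ord.
  have nth_col k : nth 0 (columns Q) (nat_of_ord k) = col k Q.
    by rewrite (nth_map k) ?nth_ord_enum // size_enum_ord.
  move=> ltij; move/(pairwiseP 0)/(_ i j): ortho.
  by rewrite !inE !nth_col size_cols !ltn_ord => /(_ isT isT ltij)/eqP.
apply/matrixP => i j; rewrite trmx_mul_dotcv mxE.
have [->|neq_ij] := eqVneq i j.
  by apply/eqP/norm1/map_f; rewrite mem_enum.
case: (ltngtP i j) => [/dot0 //|/dot0 dotji|/val_inj eq_ij].
  by rewrite dotcv_sym dotji rmorph0 mulr0.
by rewrite eq_ij eqxx in neq_ij.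
Qed.

(** Residuals are orthogonal to images, so [(1 - P)^T P = 0]. Hence [P = P^T P], which is visibly
    symmetric, and symmetry turns this identity into idempotence. *)
Lemma orthogonal_projector_sym_idem (R : realType) (d : nat)
    (U : {vspace 'cV[R]_d}) (P : 'M[R]_d) :
  orthogonal_projector U P -> P^T = P /\ P *m P = P.
Proof.
move=> projP.
have PtP : P^T *m P = P.
  apply/esym/eqP; rewrite -subr_eq0 -{1}[P]mul1mx -{1}(trmx1 _ d) -mulmxBl.
  apply/eqP/matrixP => i j; rewrite -linearB /= trmx_mul_dotcv mxE.
  (* Entry [(i, j)] of [(1 - P)^T P] pairs the residual of the [i]-th unit vector with the image of
     the [j]-th. *)
  have [Pj _] := projP (delta_mx j 0); have [_ Pi] := projP (delta_mx i 0).
  by rewrite !colE mulmxBl mul1mx; apply: (mem_orthovP Pi).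
have symP : P^T = P by rewrite -PtP trmx_mul trmxK PtP.
by split=> //; rewrite -{1}symP PtP.
Qed.

Lemma nullspace_orthogonal_projector (R : realType) (d : nat)
    (U : {vspace 'cV[R]_d}) (P : 'M[R]_d) :
  orthogonal_projector U P -> nullspace P = orthocomp U.
Proof.
move=> projP; apply/subv_anti/andP; split; apply/subvP => x.
  by move=> /nullspaceP Px0; have [_] := projP x; rewrite Px0 subr0.
move=> xU; have [PxU xPxU] := projP x; apply/nullspaceP.
(* [P x = x - (x - P x)] lies in both [U] and its complement, so it is orthogonal to itself. *)
have /mem_orthovP/(_ _ PxU) PxPx0 : P *m x \in orthocomp U.
  by rewrite -[P *m x](subKr x) memvB.
by apply: contra_eq PxPx0 => /dotcv_gt0/lt0r_neq0.
Qed.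

Lemma nullspace_deflation (R : realType) (d n r : nat) (P : 'M[R]_d)
    (K : 'M[R]_(d, n)) (Q : 'M[R]_(d, r)) :
  P^T = P -> P *m P = P ->
  orthonormal_basis (colspace (P *m K)) (columns Q) ->
  let P' := P - Q *m Q^T in
  [/\ P'^T = P', P' *m P' = P' &
      nullspace P' = (nullspace P + colspace K)%VS].
Proof.
move=> symP idemP /andP[/span_basis spanQ /orthonormal_columns_mul QtQ] P'.
rewrite span_columns in spanQ.
(* Every [Q y] has the form [P K z], which the idempotent [P] fixes. *)
have PQ : P *m Q = Q.
  apply: mulmx_cV_ext => y.
  have : Q *m y \in colspace Q by apply/colspaceP; exists y.
  rewrite spanQ => /colspaceP[z Qy].
  by rewrite -mulmxA Qy !mulmxA idemP.
have QtP : Q^T *m P = Q^T by rewrite -{1}symP -trmx_mul PQ.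
have P'P : P' *m P = P' by rewrite mulmxBl idemP -mulmxA QtP.
have P'Q : P' *m Q = 0 by rewrite mulmxBl PQ -mulmxA QtQ mulmx1 subrr.
split; first by rewrite linearB /= symP trmx_mul trmxK.
  by rewrite {2}/P' mulmxBr P'P mulmxA P'Q mul0mx subr0.
apply/subv_anti/andP; split; apply/subvP => x.
  move=> /nullspaceP/eqP; rewrite mulmxBl subr_eq0 => /eqP Px.
  have : P *m x \in colspace (P *m K).
    by rewrite -spanQ Px -mulmxA; apply/colspaceP; exists (Q^T *m x).
  case/colspaceP => y PxKy; rewrite -[x](subrK (K *m y)); apply: memv_add.
    by apply/nullspaceP; rewrite mulmxBr PxKy mulmxA subrr.
  by apply/colspaceP; exists y.
case/memv_addP => u /nullspaceP Pu0 [_ /colspaceP[y ->] ->].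
(* Since [P' = P' P], the summand [u] is killed, and [K y] may be replaced by [P K y = Q z], which
   [P'] kills too. *)
apply/nullspaceP; rewrite mulmxDr -P'P -mulmxA Pu0 mulmx0 add0r.
have : P *m K *m y \in colspace (P *m K) by apply/colspaceP; exists y.
rewrite -spanQ => /colspaceP[z PKy].
by rewrite -mulmxA [P *m (K *m y)]mulmxA PKy mulmxA P'Q mul0mx.
Qed.

Theorem theorem4p1 (R : realType) (d : nat)
    (n : nat -> nat) (K : forall j : nat, 'M[R]_(d, n j))
    (r : nat -> nat) (Q : forall j : nat, 'M[R]_(d, r j))
    (P : nat -> 'M[R]_d)
    (hP0 : orthogonal_projector (orthocomp (colspace (K 0%N))) (P 0%N))
    (hP : forall j : nat, (1 <= j)%N -> P j = P j.-1 - Q j *m (Q j)^T)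
    (hQ : forall j : nat, (1 <= j)%N ->
       orthonormal_basis (colspace (P j.-1 *m K j)) (columns (Q j)))
    (t : nat) (ht : (1 <= t)%N) :
  nullspace (P t.-1) = colspace (\mxrow_(j < t) K j).
Proof.
case: t ht => // t _ /=.
(* With [t] shifted down by one, [P t] faces [t.+1] blocks. Symmetry and idempotence join the
   induction because each deflation step consumes them. *)
suff [_ _ ->] : [/\ (P t)^T = P t, P t *m P t = P t &
    nullspace (P t) = (\sum_(j < t.+1) colspace (K j))%VS].
  by rewrite colspace_mxrow.
elim: t => [|t [symP idemP nullP]].
  have [symP idemP] := orthogonal_projector_sym_idem hP0; split=> //.
  by rewrite big_ord1 (nullspace_orthogonal_projector hP0) orthocompK_colspace.
have [] := nullspace_deflation symP idemP (hQ t.+1 isT).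
rewrite -(hP t.+1 isT) nullP => symP1 idemP1 nullP1; split=> //.
by rewrite nullP1 [RHS]big_ord_recr.
Qed.
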